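(* Every finite projective plane is super-neat: if $D$ is a $2$-$(q^2+q+1,q+1,1)$ design (a projective plane of order $q\geq 2$), then every minimum dominating set of the incidence graph of $D$ is neat.
   Context: A $2$-$(v,k,\lambda)$ design $D=(X,\mathcal{B})$ consists of a set $X$ of $v$ points and a family $\mathcal{B}$ of $k$-subsets (blocks) such that every pair of distinct points lies in exactly $\lambda$ blocks. The incidence graph $G_D$ has vertex set $X\cup\mathcal{B}$ with $x$ adjacent to $B$ iff $x\in B$. A dominating set is a set $S$ of vertices such that every vertex not in $S$ is adjacent to some vertex of $S$; $\gamma(D)$ is the minimum size of a dominating set of $G_D$, and a minimum dominating set is one of size $\gamma(D)$. For $P\subseteq X$, $\hat{L}(P)=\{B\in\mathcal{B}:B\cap P=\emptyset\}$ and $I_P=P\cup\hat{L}(P)$. A set $S$ is neat if $S=I_P$ for some $P\subseteq X$. $D$ is super-neat if every minimum dominating set of $G_D$ is neat. *)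

(* Defs.v *)
From mathcomp Require Import all_boot.

Set Implicit Arguments.
Unset Strict Implicit.
Unset Printing Implicit Defensive.

Section Domination.

Variables (V : finType) (e : rel V).

Definition dominating (S : {set V}) : bool :=
  [forall u, (u \notin S) ==> [exists w in S, e u w]].

Lemma dominating_setT : dominating setT.
Proof. by apply/forallP=> u; rewrite in_setT. Qed.

(* The minimum ranges over a nonempty collection: setT is dominating. *)
Definition domination_number : nat :=
  #|[arg min_(S < setT | dominating S) #|S|]|.

Definition minimum_dominating (S : {set V}) : bool :=
  dominating S && (#|S| == domination_number).

Lemma domination_number_le (S : {set V}) :
  dominating S -> domination_number <= #|S|.
Proof.
by rewrite /domination_number; case: arg_minnP => [|A _]; [exact: dominating_setT|apply].
Qed.

Lemma domination_number_attained : exists S, minimum_dominating S.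
Proof.
rewrite /minimum_dominating /domination_number.
case: arg_minnP => [|A dA _]; first exact: dominating_setT.
by exists A; rewrite dA eqxx.
Qed.

End Domination.

(* The family of blocks is indexed by the finite type B, so that repeated     *)
(* blocks are allowed: pts b is the set of points of the block b. A family    *)
(* without repetitions Bs : {set {set X}} is the case of val on               *)
(* {b : {set X} | b \in Bs}.                                                  *)
Definition design (X B : finType) (pts : B -> {set X}) (v k lambda : nat) :
    Prop :=
  [/\ #|X| = v,
      forall b, #|pts b| = k
    & forall x y, x != y ->
        #|[set b | (x \in pts b) && (y \in pts b)]| = lambda].

Section IncidenceGraph.

Variables (X B : finType) (pts : B -> {set X}).

(* The vertex set, the disjoint union of points and blocks, is X + B. *)
Definition incidence_graph : rel (X + B) := fun u w =>
  match u, w with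
  | inl x, inr b => x \in pts b
  | inr b, inl x => x \in pts b
  | _, _ => false
  end.

Definition missed_blocks (P : {set X}) : {set B} :=
  [set b | pts b :&: P == set0].

Definition neat_set (P : {set X}) : {set X + B} :=
  [set inl x | x in P] :|: [set inr b | b in missed_blocks P].

Definition neat (S : {set X + B}) : Prop := exists P, S = neat_set P.

Definition super_neat : Prop :=
  forall S, minimum_dominating incidence_graph S -> neat S.

End IncidenceGraph.

(* Main.v *)
(** Write a dominating set as a set [P] of points together with a set [L] of
    lines, so that [L] contains the lines missed by [P] and [P] the points on no
    line of [L].  Since any two points are joined, [P] meets at most [1 + q|P|]
    lines, whence [q^2 + q <= |L| + q|P|], and dually [q^2 + q <= |P| + q|L|].
    The punctured line [l \ {x}] and the lines other than [l] through [x]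
    dominate, so [|P| + |L| <= 2q] for a minimum dominating set.  Hence both
    inequalities are equalities, and [L] consists of the missed lines only. *)
Require Import Defs.
From mathcomp Require Import all_boot.
From mathcomp Require Import zify.

(** Fix [a] in [P], whose set has at most [q + 1] elements. Every further [N i] meets [N a], so it
    adds at most [q] new ones. This serves both pencils of points and lines as point sets. *)
Lemma card_bigcup_meet (A T : finType) (N : A -> {set T}) (q : nat)
    (P : {set A}) :
  (forall a, #|N a| <= q.+1) -> (forall a a', N a :&: N a' != set0) ->
  #|\bigcup_(a in P) N a| <= q * #|P| + 1.
Proof.
move=> cN mN; have [->|[a aP]] := set_0Vmem P; first by rewrite big_set0 cards0.
have -> : q * #|P| + 1 = q.+1 + \sum_(i in P | i != a) q.
  by rewrite mulnC -sum_nat_const (bigD1 a) //= addn1 -addSn.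
rewrite (bigD1 a) //=.
elim/big_rec2: _ => [|i n U _ IH]; first by rewrite setU0 addn0.
have i1 : #|(N a :|: U) :&: N i| > 0.
  rewrite card_gt0; have /set0Pn[x] := mN a i; rewrite in_setI => /andP[xa xi].
  by apply/set0Pn; exists x; rewrite !inE xa xi.
have := cardsU (N a :|: U) (N i).
by rewrite -setUA (setUC U); have := cN i; lia.
Qed.

Section ProjectivePlane.

Variables (q : nat) (X B : finType) (pts : B -> {set X}).
Hypothesis q_gt0 : 0 < q.
Hypothesis hD : design pts (q ^ 2 + q + 1) (q + 1) 1.

Let pencil (x : X) : {set B} := [set b | x \in pts b].

Lemma card_points : #|X| = q ^ 2 + q + 1. Proof. by case: hD. Qed.

Lemma card_pts b : #|pts b| = q + 1. Proof. by case: hD. Qed.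

Lemma card_pencil_meet x y : x != y -> #|pencil x :&: pencil y| = 1.
Proof.
case: hD => _ _ h /h <-; apply: eq_card => b; by rewrite !inE.
Qed.

Lemma two_points_on_line x y b c : x != y ->
  x \in pts b -> y \in pts b -> x \in pts c -> y \in pts c -> b = c.
Proof.
move=> /card_pencil_meet /eqP /cards1P[d dE] xb yb xc yc.
have : b \in pencil x :&: pencil y by rewrite !inE xb yb.
have : c \in pencil x :&: pencil y by rewrite !inE xc yc.
by rewrite dE !inE => /eqP -> /eqP.
Qed.

(** Double counting of incident pairs. Its instances yield the size of a pencil, the number of
    lines, and that any two lines meet. *)
Lemma sum_card_pencil (Y : {set X}) (C : {set B}) :
  \sum_(y in Y) #|pencil y :&: C| = \sum_(b in C) #|pts b :&: Y|.
Proof.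
transitivity (\sum_(y in Y) \sum_(b in C | y \in pts b) 1).
  apply: eq_bigr => y _; rewrite sum1dep_card; apply: eq_card => b.
  by rewrite !inE andbC.
rewrite (exchange_big_dep (mem C)) /=; last by move=> ? ? _ /andP[].
apply: eq_bigr => b bC; rewrite sum1dep_card; apply: eq_card => y.
by rewrite !inE bC andbC.
Qed.

(** Each of the [q ^ 2 + q] other points is on exactly one line through [x], and each such line
    carries [q] of them; cancel [q > 0]. *)
Lemma card_pencil x : #|pencil x| = q + 1.
Proof.
have := sum_card_pencil [set~ x] (pencil x).
rewrite (eq_bigr (fun=> 1)); last first.
  by move=> y; rewrite !inE => yx; rewrite card_pencil_meet.
rewrite sum1_card [RHS](eq_bigr (fun=> q)); last first.
  move=> b; rewrite inE => xb; have := cardsD1 x (pts b).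
  by rewrite xb card_pts setDE addnC => /addnI.
by rewrite sum_nat_const cardsC1 card_points => h; nia.
Qed.

Lemma card_lines : #|B| = q ^ 2 + q + 1.
Proof.
have := sum_card_pencil setT setT.
rewrite (eq_bigr (fun=> q + 1)) => [|x _]; last by rewrite setIT card_pencil.
rewrite [RHS](eq_bigr (fun=> q + 1)) => [|b _]; last by rewrite setIT card_pts.
by rewrite !sum_nat_const !cardsT card_points => h; nia.
Qed.

Lemma pencils_meet x y : pencil x :&: pencil y != set0.
Proof.
have [->|/card_pencil_meet xy] := eqVneq x y; last by rewrite -card_gt0 xy.
by rewrite setIid -card_gt0 card_pencil addn1.
Qed.

Lemma lines_meet b c : pts b :&: pts c != set0.
Proof.
apply/negP => /eqP bc0.
have /card_gt0P[x xc] : 0 < #|pts c| by rewrite card_pts addn1.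
have xb : x \notin pts b.
  by apply/negP => xb; have /setP/(_ x) := bc0; rewrite !inE xb xc.
(* The [q + 1] lines through [x] meet [b] in [q + 1] points altogether, and in
   at most one point each. *)
have := sum_card_pencil (pts b) (pencil x).
rewrite (eq_bigr (fun=> 1)); last first.
  move=> y yb; rewrite card_pencil_meet //.
  by apply: contraNneq xb => <-.
(* The line [c] contributes nothing, so only [q] lines are left to account for the [q + 1]
   points. *)
rewrite sum1_card card_pts (bigD1 c) ?inE //= setIC bc0 cards0 add0n.
have le1 : \sum_(i in pencil x | i != c) #|pts i :&: pts b|
            <= \sum_(i in pencil x | i != c) 1.
  apply: leq_sum => d /andP[]; rewrite inE => xd _; rewrite leqNgt.
  apply/negP => /card_gt1P[y [z [/setIP[yd yb] /setIP[zd zb] yz]]].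
  by case/negP: xb; rewrite (two_points_on_line _ _ b d yz).
move=> h; move: le1; rewrite -h.
have := card_pencil x; rewrite -sum1_card (bigD1 c) ?inE //=; lia.
Qed.

Lemma domination_number_plane : domination_number (incidence_graph pts) <= 2 * q.
Proof.
have /card_gt0P[l _] : 0 < #|B| by rewrite card_lines addn1.
have /card_gt0P[x xl] : 0 < #|pts l| by rewrite card_pts addn1.
pose S := [set inl y | y in pts l :\ x] :|: [set inr b | b in pencil x :\ l].
have cS : #|S| <= 2 * q.
  apply: leq_trans (leq_card_setU _ _) _.
  apply: leq_trans (leq_add (leq_imset_card _ _) (leq_imset_card _ _)) _.
  have := cardsD1 x (pts l); have := cardsD1 l (pencil x).
  rewrite xl inE xl card_pts card_pencil; lia.
apply: leq_trans cS; apply: domination_number_le.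
have inS y : y \in pts l -> y != x -> inl y \in S.
  by move=> yl yx; rewrite inE imset_f // !inE yx.
have inrS b : x \in pts b -> b != l -> inr b \in S.
  by move=> xb bl; rewrite inE orbC imset_f // !inE bl.
apply/forallP => -[y|b]; apply/implyP => uS; apply/existsP.
(* For [y = x] any other line through [x] will do, as [q > 0]. Otherwise take a line joining [x] and
   [y]: if it were [l], then [y] would be in [S]. *)
- suff [b xb /andP[yb bl]] : exists2 b, x \in pts b & (y \in pts b) && (b != l).
    by exists (inr b); rewrite inrS.
  have [->|yx] := eqVneq y x.
    have : 0 < #|pencil x :\ l|.
      have := cardsD1 l (pencil x); rewrite inE xl card_pencil; lia.
    by case/card_gt0P => b; rewrite !inE => /andP[bl xb]; exists b; rewrite ?xb.
  have /set0Pn[b] := pencils_meet x y; rewrite !inE => /andP[xb yb].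
  exists b; rewrite ?yb //=; apply: contraNneq uS => bl.
  by rewrite inS // -bl.
(* Dually: any other point of [l] if [b = l], else a common point of [l] and [b], which is not [x]
   because [b] is not in [S]. *)
- suff [y yl /andP[yb yx]] : exists2 y, y \in pts l & (y \in pts b) && (y != x).
    by exists (inl y); rewrite inS.
  have [->|bl] := eqVneq b l.
    have : 0 < #|pts l :\ x|.
      have := cardsD1 x (pts l); rewrite xl card_pts; lia.
    by case/card_gt0P => y; rewrite !inE => /andP[yx yl]; exists y; rewrite ?yl.
  have /set0Pn[y /setIP[yl yb]] := lines_meet l b.
  exists y; rewrite ?yb //=; apply: contraNneq uS => yx.
  by rewrite inrS // -yx.
Qed.

(** Minimality enters only through the size bound [2 * q]. *)
Lemma dominating_neat (S : {set X + B}) :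
  dominating (incidence_graph pts) S -> #|S| <= 2 * q -> neat pts S.
Proof.
move=> /forallP domS cS.
pose P := [set x | inl x \in S]; pose L := [set b | inr b \in S].
have SE : S = [set inl x | x in P] :|: [set inr b | b in L].
  apply/setP => -[x|b]; rewrite !inE.
    rewrite mem_imset ?inE; last by move=> ? ? [].
    by rewrite [X in _ || X](_ : _ = false) ?orbF //; apply/imsetP => -[].
  rewrite [X in _ || X]mem_imset ?inE; last by move=> ? ? [].
  by rewrite [X in X || _](_ : _ = false) //; apply/imsetP => -[].
have PL : #|P| + #|L| <= 2 * q.
  apply: leq_trans cS; rewrite [in leqRHS]SE cardsU.
  rewrite !card_imset; try by move=> ? ? [].
  rewrite (_ : _ :&: _ = set0) ?cards0 ?subn0 //.
  apply/setP => u; rewrite !inE; apply/negP => /andP[/imsetP[x _ ->]].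
  by case/imsetP.
have missedL : missed_blocks pts P \subset L.
  apply/subsetP => b; rewrite !inE => /eqP bP; apply: contraT => bS.
  have /implyP/(_ bS)/existsP[[x|c]] := domS (inr b); last by rewrite andbF.
  by case/andP=> xS /= xb; have /setP/(_ x) := bP; rewrite !inE xS xb.
have uncoveredP : ~: (\bigcup_(b in L) pts b) \subset P.
  apply/subsetP => x; rewrite in_setC [x \in P]inE => xL; apply: contraT => xS.
  have /implyP/(_ xS)/existsP[[y|b]] := domS (inl x); first by rewrite andbF.
  case/andP=> bS xb; case/negP: xL; apply/bigcupP; exists b => //; by rewrite inE.
have missedE : missed_blocks pts P = ~: \bigcup_(x in P) pencil x.
  apply/setP => b; rewrite !inE; apply/eqP/negP => [bP /bigcupP[x xP]|h].
    by rewrite inE => xb; have /setP/(_ x) := bP; rewrite !inE in xP *; rewrite xP xb.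
  apply/setP => x; rewrite !inE; apply/negP => /andP[xb xS].
  by case: h; apply/bigcupP; exists x; rewrite inE.
have hit : #|\bigcup_(x in P) pencil x| <= q * #|P| + 1.
  apply: card_bigcup_meet pencils_meet => x; by rewrite card_pencil addn1.
have cov : #|\bigcup_(b in L) pts b| <= q * #|L| + 1.
  apply: card_bigcup_meet lines_meet => b; by rewrite card_pts addn1.
have cm := cardsC (\bigcup_(x in P) pencil x).
have cu := cardsC (\bigcup_(b in L) pts b).
rewrite -missedE card_lines in cm; rewrite card_points in cu.
have cP := subset_leq_card uncoveredP.
suff LE : missed_blocks pts P = L by exists P; rewrite /neat_set LE.
(* It remains to bound [|L|] by the number of missed lines. From [q ^ 2 + q <= |P| + q|L|] and
   [|P| + |L| <= 2q] follows [(q - 1)(|L| - q) >= 0], hence [(q - 1)(q - |P|) >= 0]. So at least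
   [q(q + 1 - |P|) >= 2q - |P| >= |L|] lines are missed. *)
apply/eqP; rewrite eqEcard missedL /=; nia.
Qed.

End ProjectivePlane.

Theorem theorem4p2 (q : nat) (hq : 2 <= q)
    (X B : finType) (pts : B -> {set X})
    (hD : design pts (q ^ 2 + q + 1) (q + 1) 1) :
  super_neat pts.
Proof.
have q_gt0 : 0 < q by apply: ltnW.
move=> S /andP[domS /eqP cS].
by apply: (dominating_neat q _ _ pts q_gt0 hD) => //; rewrite cS (domination_number_plane q).
Qed.
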